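(* Let $f:\mathbb{R}^n\to\mathbb{R}$ be convex and continuously differentiable with a minimizer $x_*$, and suppose that $\nabla f$ is Lipschitz continuous with constant $L>0$. Let $x_0\in\mathbb{R}^n$, let $(e_k)_{k\ge 0}$ be a sequence in $\mathbb{R}^n$ with $$\sum_{k=0}^\infty\|e_k\|<\infty,$$ and define $x_{k+1}=x_k-\frac1L\big(\nabla f(x_k)+e_k\big)$ for $k\ge0$. For $k\ge1$ let $\bar x_k=\frac1k\sum_{i=1}^k x_i$. Then $$f(\bar x_k)-f(x_* )=\mathcal{O}(1/k),$$ that is, there is a constant $K\ge0$, independent of $k$, such that $f(\bar x_k)-f(x_* )\le K/k$ for all $k\ge 1$.
   Context: $\|\cdot\|$ is the Euclidean norm on $\mathbb{R}^n$. Lipschitz continuity of the gradient with constant $L$ means $\|\nabla f(x)-\nabla f(y)\|\le L\|x-y\|$ for all $x,y\in\mathbb{R}^n$. Strong convexity of $f$ is not assumed. *)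

(* Defs.v *)
From HB Require Import structures.
From mathcomp Require Import all_boot all_order all_algebra.
From mathcomp Require Import all_classical all_reals all_analysis.

Set Implicit Arguments.
Unset Strict Implicit.
Unset Printing Implicit Defensive.

Import Order.TTheory GRing.Theory Num.Theory.
Import numFieldNormedType.Exports.

Local Open Scope ring_scope.

(* The library's norm `|v| on 'rV[R]_n is the sup norm. It induces the same
   topology, hence the same differentiability and continuity, but not the same
   Lipschitz constants. *)
Definition enorm (R : realType) (n : nat) (v : 'rV[R]_n) : R :=
  Num.sqrt (\sum_(i < n) v ord0 i ^+ 2).

(* 'D_v f x is a total operator, so this is the gradient only where f is
   differentiable. *)
Definition grad (R : realType) (n : nat) (f : 'rV[R]_n -> R) (x : 'rV[R]_n) :
    'rV[R]_n :=
  \row_(i < n) 'D_(delta_mx ord0 i) f x.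

(* Main.v *)
Require Import Defs.
From HB Require Import structures.
From mathcomp Require Import all_boot all_order all_algebra.
From mathcomp Require Import all_classical all_reals all_analysis.
From mathcomp Require Import lra.

Set Implicit Arguments.
Unset Strict Implicit.
Unset Printing Implicit Defensive.

Import Order.TTheory GRing.Theory Num.Theory.
Import numFieldNormedType.Exports.

Local Open Scope classical_set_scope.
Local Open Scope ring_scope.

(** Write [x' := x - L^-1 (grad f x + e)]. The descent lemma bounds [f x'] from
    [f x], and the gradient inequality of convexity bounds [f x] from [f z]; after
    eliminating [grad f x] through the step, they add up to
      [f x' - f z <= L/2 (|x - z|^2 - |x' - z|^2) + |e| |x' - z|].
    For [z] the minimizer the left side is nonnegative, so the distance to [z]
    grows by at most [2|e|/L] per step and hence stays bounded by some [D].
    Telescoping bounds the sum of the gaps by [L/2 |x_0 - z|^2 + D * sum |e_k|]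
    uniformly in [k], and Jensen's inequality yields the rate. *)

Definition dotp (R : realType) (n : nat) (u v : 'rV[R]_n) : R :=
  \sum_(i < n) u ord0 i * v ord0 i.

Section DotProduct.
Variables (R : realType) (n : nat).
Implicit Types (u v w : 'rV[R]_n) (a : R).

Lemma dotpC u v : dotp u v = dotp v u.
Proof. by apply: eq_bigr => i _; rewrite mulrC. Qed.

Lemma dotpDl u v w : dotp (u + v) w = dotp u w + dotp v w.
Proof. by rewrite -big_split; apply: eq_bigr => i _; rewrite mxE mulrDl. Qed.

Lemma dotpZl a u v : dotp (a *: u) v = a * dotp u v.
Proof. by rewrite mulr_sumr; apply: eq_bigr => i _; rewrite mxE mulrA. Qed.

Lemma dotpNl u v : dotp (- u) v = - dotp u v.
Proof. by rewrite -scaleN1r dotpZl mulN1r. Qed.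

Lemma dotpDr u v w : dotp u (v + w) = dotp u v + dotp u w.
Proof. by rewrite dotpC dotpDl !(dotpC u). Qed.

Lemma dotpZr a u v : dotp u (a *: v) = a * dotp u v.
Proof. by rewrite dotpC dotpZl dotpC. Qed.

Lemma dotpNr u v : dotp u (- v) = - dotp u v.
Proof. by rewrite dotpC dotpNl dotpC. Qed.

Definition dotpE := (dotpDl, dotpDr, dotpZl, dotpZr, dotpNl, dotpNr).

Lemma dotp0r u : dotp u 0 = 0.
Proof. by rewrite -(scale0r u) dotpZr mul0r. Qed.

Lemma dotp_sumr u (I : Type) (r : seq I) (F : I -> 'rV[R]_n) :
  dotp u (\sum_(i <- r) F i) = \sum_(i <- r) dotp u (F i).
Proof. by apply: (big_morph _ (dotpDr u) (dotp0r u)). Qed.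

Lemma dotp_ge0 u : 0 <= dotp u u.
Proof. by apply: sumr_ge0 => i _; rewrite -expr2 sqr_ge0. Qed.

Lemma enorm_ge0 u : 0 <= enorm u.
Proof. exact: sqrtr_ge0. Qed.

Lemma enorm_sqr u : enorm u ^+ 2 = dotp u u.
Proof.
have -> : dotp u u = \sum_(i < n) u ord0 i ^+ 2.
  by apply: eq_bigr => i _; rewrite expr2.
by rewrite sqr_sqrtr//; apply: sumr_ge0 => i _; exact: sqr_ge0.
Qed.

Lemma enorm_eq0 u : enorm u = 0 -> u = 0.
Proof.
move=> u0; have := enorm_sqr u; rewrite u0 expr0n /= => /esym/eqP.
rewrite psumr_eq0; last by move=> i _; rewrite -expr2 sqr_ge0.
move=> /allP uu0; apply/rowP => i; rewrite mxE.
by have := uu0 i (mem_index_enum i); rewrite -expr2 sqrf_eq0 => /eqP.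
Qed.

Lemma enormZ a u : 0 <= a -> enorm (a *: u) = a * enorm u.
Proof.
move=> a0; apply/eqP; rewrite -(@eqrXn2 _ 2)// ?mulr_ge0 ?enorm_ge0//.
by rewrite exprMn !enorm_sqr !dotpE mulrA -expr2.
Qed.

Lemma Cauchy_Schwarz u v : dotp u v <= enorm u * enorm v.
Proof.
have [/enorm_eq0 ->|u0] := eqVneq (enorm u) 0.
  by rewrite dotpC dotp0r mulr_ge0 ?enorm_ge0.
have [/enorm_eq0 ->|v0] := eqVneq (enorm v) 0.
  by rewrite dotp0r mulr_ge0 ?enorm_ge0.
have uv0 : 0 < enorm u * enorm v by rewrite mulr_gt0 ?lt_def ?u0 ?v0 ?enorm_ge0.
(* With both norms positive, this square expands to [2 * |u| * |v| * (|u| * |v| - dotp u v)], and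
   dividing by the positive factor gives the claim. *)
have := dotp_ge0 (enorm v *: u - enorm u *: v).
rewrite !dotpE -!enorm_sqr (dotpC v u) => h.
rewrite -(ler_pM2l uv0); nra.
Qed.

End DotProduct.

Section Gradient.
Variables (R : realType) (n : nat) (f : 'rV[R]_n -> R).
Hypothesis f_diff : forall y, differentiable f y.
Implicit Types (x y v : 'rV[R]_n).

Lemma derive_grad x v : 'D_v f x = dotp (grad f x) v.
Proof.
rewrite deriveE// {1}(row_sum_delta v) linear_sum; apply: eq_bigr => i _.
by rewrite linearZ /= mxE deriveE// mulrC.
Qed.

(** For each increment, the difference quotient at [t] in direction 1 coincides with that of [f] at
    [x + t *: v] in direction [v], so the limits agree. *)
Lemma is_derive_line x v (t : R) :
  is_derive t 1 (fun s : R => f (x + s *: v)) (dotp (grad f (x + t *: v)) v).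
Proof.
have growth : (fun h : R => h^-1 *: (((fun s : R => f (x + s *: v)) \o shift t)
      (h *: 1) - f (x + t *: v))) =
    (fun h => h^-1 *: ((f \o shift (x + t *: v)) (h *: v) - f (x + t *: v))).
  apply/funext => h /=; congr (_ *: (f _ - _)).
  by rewrite [h *: 1]mulr1 scalerDl addrCA.
split.
  by rewrite /derivable growth; exact: diff_derivable.
by rewrite -derive_grad /derive growth.
Qed.

Lemma convex_grad_le x y :
  convex_function [set: convex_lmodType 'rV[R]_n] f ->
  f x + dotp (grad f x) (y - x) <= f y.
Proof.
move=> f_convex; rewrite -derive_grad addrC -lerBrDr.
have cvD : derivable f x (y - x) by exact: diff_derivable.
(* Only increments [h] in (0, 1] are convex weights, so the derivative is taken as a limit from the
   right. For such [h], convexity bounds each difference quotient by [f y - f x]. *)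
rewrite /derive cvg_at_rightE//; apply: limr_le.
  by apply/cvg_ex; exists ('D_(y - x) f x); exact: cvg_dnbhs_at_right.
near=> h.
have h0 : 0 < h by near: h; exact: nbhs_right_gt.
have h1 : h <= 1 by near: h; apply: nbhs_right_le.
rewrite /= -[_ *: _]/(_ * _) ler_pdivrMl//.
have := @f_convex (Itv01 (ltW h0) h1) y x.
rewrite !inE => /(_ I I); rewrite convRE /=.
have -> : conv (Itv01 (ltW h0) h1) (y : convex_lmodType 'rV[R]_n) x =
    h *: (y - x) + x.
  rewrite /conv /= /unstable.onem scalerBl scale1r scalerBr.
  by rewrite addrCA addrC.
rewrite /unstable.onem; lra.
Unshelve. all: by end_near. Qed.

(** The mean value theorem takes the place of integration along the segment: [phi] is [f] on the
    segment minus the linear and quadratic terms of the bound, and the Lipschitz condition with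
    Cauchy-Schwarz makes its derivative nonpositive on (0, 1). *)
Lemma descent_lemma (L : R) x v :
  (forall y z, enorm (grad f y - grad f z) <= L * enorm (y - z)) ->
  f (x + v) <= f x + dotp (grad f x) v + L / 2 * enorm v ^+ 2.
Proof.
move=> grad_lip.
set a := dotp (grad f x) v; set b := L / 2 * enorm v ^+ 2.
pose phi (t : R) : R := f (x + t *: v) - (t * a + t ^+ 2 * b).
pose dphi (t : R) : R := dotp (grad f (x + t *: v)) v - (a + t * b *+ 2).
have dphiE (t : R) : is_derive t 1 phi (dphi t).
  have := is_derive_line x v t => ?.
  rewrite /phi /dphi; apply: is_derive_eq.
  rewrite !scaler0 add0r [a%:A]mulr1 [t%:A]mulr1 add0r -[b *: _]/(b * _); lra.
have [c c01 ] : exists2 c, c \in `]0, 1[%R & phi 1 - phi 0 = dphi c * (1 - 0).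
  apply: MVT => //.
  apply: derivable_within_continuous => t _; exact: ex_derive.
rewrite /phi scale1r scale0r addr0 !subr0 mulr1 => e.
have : dphi c <= 0.
  rewrite /dphi /a /b.
  have c0 : 0 < c by rewrite (itvP c01).
  have := Cauchy_Schwarz (grad f (x + c *: v) - grad f x) v.
  have := grad_lip (x + c *: v) x.
  rewrite addrAC subrr add0r (enormZ _ (ltW c0)) dotpDl dotpNl.
  have := enorm_ge0 v; nra.
rewrite -e; lra.
Qed.

(** Each value [f (x i)] lies above the tangent at the mean [m]; summed over [i], the linear terms
    cancel since the deviations [x i - m] add up to 0. *)
Lemma convex_average_le (k : nat) (x : nat -> 'rV[R]_n) :
  convex_function [set: convex_lmodType 'rV[R]_n] f ->
  k%:R * f (k%:R^-1 *: \sum_(0 <= i < k) x i) <= \sum_(0 <= i < k) f (x i).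
Proof.
move=> f_convex; case: k => [|k]; first by rewrite mul0r big_geq.
set m := _ *: _.
apply: (@le_trans _ _ (\sum_(0 <= i < k.+1) (f m + dotp (grad f m) (x i - m)))).
  rewrite big_split /= -dotp_sumr sumrB !sumr_const_nat subn0 mulr_natl.
  rewrite (_ : _ - _ = 0) ?dotp0r ?addr0//.
  by rewrite /m -scaler_nat scalerA mulfV ?pnatr_eq0// scale1r subrr.
by apply: ler_sum => i _; exact: convex_grad_le.
Qed.

Lemma gradient_step_le (L : R) x e z (x' := x - L^-1 *: (grad f x + e)) :
  0 < L ->
  (forall y z, enorm (grad f y - grad f z) <= L * enorm (y - z)) ->
  convex_function [set: convex_lmodType 'rV[R]_n] f ->
  f x' - f z <= L / 2 * (enorm (x - z) ^+ 2 - enorm (x' - z) ^+ 2)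
                + enorm e * enorm (x' - z).
Proof.
move=> L0 grad_lip f_convex.
set v := - (L^-1 *: (grad f x + e)).
have gradE : grad f x = - (L *: v) - e.
  by rewrite scalerN opprK scalerA mulfV ?gt_eqF// scale1r addrK.
have x'E : x' = x + v by [].
clearbody v x'.
have := descent_lemma x v grad_lip.
have := convex_grad_le x z f_convex.
have := Cauchy_Schwarz (- e) (x' - z).
have -> : enorm (- e) = enorm e.
  by rewrite /enorm; congr Num.sqrt; apply: eq_bigr => i _; rewrite mxE sqrrN.
have -> : x' - z = (x - z) + v by rewrite x'E addrAC.
rewrite -x'E -(opprB x z) gradE !enorm_sqr.
move: (x - z) => u.
(* In terms of [u = x - z] and the step [v], the descent and gradient inequalities add up to the
   bound with [- dotp e (u + v)] as error term; Cauchy-Schwarz is used for that term alone. *)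
rewrite !dotpE (dotpC v u); lra.
Qed.

End Gradient.

(** If [d'] exceeded the bound, then [L * (d' - d) > 2 * c]; multiplying by [d' + d > 0] gives
    [L * (d' ^+ 2 - d ^+ 2) > 2 * c * d'], against the assumption. *)
Lemma perturbed_distance_le (R : realFieldType) (L d d' c : R) :
  0 < L -> 0 <= d -> 0 <= d' -> 0 <= c ->
  0 <= L / 2 * (d ^+ 2 - d' ^+ 2) + c * d' -> d' <= d + 2 / L * c.
Proof.
move=> L0 d0 d'0 c0 h; rewrite leNgt; apply/negP => dd'.
have h1 : 2 * c < L * (d' - d).
  by rewrite -ltr_pdivrMl// mulrA [_^-1 * 2]mulrC ltrBrDl.
have d'_gt0 : 0 < d'.
  by apply: le_lt_trans dd'; rewrite addr_ge0// mulr_ge0// divr_ge0// ltW.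
have h2 : 2 * c * (d' + d) < L * (d' - d) * (d' + d).
  by rewrite ltr_pM2r// ltr_wpDr.
have h3 : 0 <= c * d by rewrite mulr_ge0.
lra.
Qed.

Lemma partial_sum_bounded (R : realType) (u : nat -> R) :
  (forall k, 0 <= u k) -> (\sum_(0 <= k <oo) (u k)%:E < +oo)%E ->
  exists S : R, forall k, \sum_(0 <= i < k) u i <= S.
Proof.
move=> u0 usum; exists (fine (\sum_(0 <= k <oo) (u k)%:E)%E) => k.
have u0E : (forall i, (0 <= i)%N -> true -> 0 <= (u i)%:E)%E.
  by move=> i _ _; rewrite lee_fin.
rewrite -lee_fin fineK; last by rewrite ge0_fin_numE// nneseries_ge0.
by rewrite -sumEFin; exact: nneseries_lim_ge.
Qed.

Theorem theorem2p6 (R : realType) (n : nat) (f : 'rV[R]_n -> R)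
    (xstar : 'rV[R]_n) (L : R)
    (x0 : 'rV[R]_n) (e x : nat -> 'rV[R]_n)
    (f_convex : convex_function [set: convex_lmodType 'rV[R]_n] f)
    (f_diff : forall y, differentiable f y)
    (grad_cont : continuous (grad f))
    (f_min : forall y, f xstar <= f y)
    (L_gt0 : 0 < L)
    (grad_lip : forall y z, enorm (grad f y - grad f z) <= L * enorm (y - z))
    (e_summable : (\sum_(0 <= k <oo) (enorm (e k))%:E < +oo)%E)
    (x_init : x 0%N = x0)
    (x_step : forall k, x k.+1 = x k - L^-1 *: (grad f (x k) + e k)) :
  exists2 K : R, 0 <= K &
    forall k : nat, (1 <= k)%N ->
      f (k%:R^-1 *: \sum_(1 <= i < k.+1) x i) - f xstar <= K / k%:R.
Proof.
have e_ge0 k : 0 <= enorm (e k) by exact: enorm_ge0.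
have [S Sub] := partial_sum_bounded e_ge0 e_summable.
have S0 : 0 <= S by have := Sub 0%N; rewrite big_geq.
pose d k := enorm (x k - xstar).
have d_ge0 k : 0 <= d k by exact: enorm_ge0.
have step k : f (x k.+1) - f xstar <=
    L / 2 * (d k ^+ 2 - d k.+1 ^+ 2) + enorm (e k) * d k.+1.
  by rewrite /d x_step; exact: gradient_step_le.
have dist k : d k <= d 0%N + 2 / L * \sum_(0 <= i < k) enorm (e i).
  elim: k => [|k IH]; first by rewrite big_geq// mulr0 addr0.
  rewrite big_nat_recr//= mulrDr addrA (le_trans _ (lerD IH (lexx _)))//.
  apply: perturbed_distance_le => //.
  by apply: le_trans (step k); rewrite subr_ge0.
pose D := d 0%N + 2 / L * S.
have dD k : d k <= D.
  apply: le_trans (dist k) _; rewrite lerD2l ler_wpM2l// divr_ge0//; exact: ltW.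
(* The term [- d k ^+ 2] and the exact partial sum of errors are kept so that the induction closes;
   they are bounded by 0 and [S] only at the end. *)
have telescoped k : \sum_(0 <= i < k) (f (x i.+1) - f xstar) <=
    L / 2 * (d 0%N ^+ 2 - d k ^+ 2) + D * \sum_(0 <= i < k) enorm (e i).
  elim: k => [|k IH]; first by rewrite !big_geq// subrr !mulr0 addr0.
  rewrite !big_nat_recr//=.
  have := step k; have := ler_wpM2l (e_ge0 k) (dD k.+1); lra.
have D0 : 0 <= D := le_trans (d_ge0 0%N) (dD 0%N).
exists (L / 2 * d 0%N ^+ 2 + D * S).
  by rewrite addr_ge0 ?mulr_ge0 ?sqr_ge0 ?invr_ge0 ?(ltW L_gt0).
move=> k k_gt0.
have k0 : 0 < k%:R :> R by rewrite ltr0n.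
(* The average runs over [x 1], ..., [x k]; shifting the index matches it with the gaps at [x i.+1]
   in [telescoped]. *)
rewrite ler_pdivlMr// big_add1 mulrC mulrBr.
have := convex_average_le f_diff k (fun i => x i.+1) f_convex.
have := telescoped k; rewrite sumrB sumr_const_nat subn0 -[_ *+ k]mulr_natl.
have := ler_wpM2l D0 (Sub k).
have : 0 <= L / 2 * d k ^+ 2 by rewrite mulr_ge0 ?sqr_ge0 ?divr_ge0 ?(ltW L_gt0).
rewrite /=; lra.
Qed.
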